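(* Let $t\ge 1$ be an integer and let $\mathcal{D}$ be a $t$-$(v,k,1)$ design with $k\geq 2t$. If $v\geq k+t$ and $t+1\leq h\leq k-t+1$, then the hypergraph $H_{\mathcal{D},h}$ is $t$-e.c.
   Context: A $t$-$(v,k,\lambda)$ design is a pair $\mathcal{D}=(V,\mathcal{B})$ where $V$ is a set of $v$ points and $\mathcal{B}$ is a collection of $k$-subsets of $V$ (blocks) such that every $t$-subset of $V$ is contained in exactly $\lambda$ blocks. For $3\le h\le k$, $H_{\mathcal{D},h}$ is the $h$-uniform hypergraph with vertex set $V$ whose edges are all $h$-subsets of the blocks of $\mathcal{D}$ (for each block $B$, all $\binom{k}{h}$ $h$-subsets of $B$ are edges). An $h$-uniform hypergraph $H$ is $n$-e.c.\ if for every set $S\subseteq V(H)$ with $|S|=n$ and every $T\subseteq S$, there is $X\subseteq V(H)\setminus S$ with $|X|=h-1$ such that $X\cup\{z\}$ is an edge for every $z\in T$ and $X\cup\{s\}$ is not an edge for every $s\in S\setminus T$. *)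

(* Defs.v *)
From mathcomp Require Import all_boot.

Set Implicit Arguments.
Unset Strict Implicit.
Unset Printing Implicit Defensive.

(** A [t]-[(v, k, lambda)] design with point set the finite type [V].
    Blocks form a set: when [lambda = 1] and [t <= k <= v], a repeated block
    would already violate the covering condition, so nothing is lost by not
    allowing multiplicities. *)
Definition is_design (V : finType) (B : {set {set V}}) (t v k lambda : nat) :=
  [/\ #|V| = v,
      forall b : {set V}, b \in B -> #|b| = k
    & forall A : {set V}, #|A| = t -> #|[set b in B | A \subset b]| = lambda].

Record uniform_hypergraph (V : finType) (h : nat) := UniformHypergraph {
  edges : {set {set V}};
  edges_uniform : forall e : {set V}, e \in edges -> #|e| = h
}.

Definition design_edges (V : finType) (B : {set {set V}}) (h : nat) :
    {set {set V}} :=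
  [set e : {set V} | (#|e| == h) && [exists b in B, e \subset b]].

Lemma design_edges_uniform (V : finType) (B : {set {set V}}) (h : nat)
    (e : {set V}) :
  e \in design_edges B h -> #|e| = h.
Proof. by rewrite inE => /andP[/eqP]. Qed.

Definition design_hypergraph (V : finType) (B : {set {set V}}) (h : nat) :
    uniform_hypergraph V h :=
  UniformHypergraph (@design_edges_uniform V B h).

(** [n]-existential closure. In every use [h] is positive, so [h - 1] is the
    true difference. *)
Definition existentially_closed (V : finType) (h : nat)
    (H : uniform_hypergraph V h) (n : nat) : Prop :=
  forall S : {set V}, #|S| = n ->
  forall T : {set V}, T \subset S ->
  exists X : {set V},
    [/\ X \subset ~: S,
        #|X| = h - 1,
        forall z, z \in T -> X :|: [set z] \in edges H
      & forall s, s \in S :\: T -> X :|: [set s] \notin edges H].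

(* Main.v *)
(** Since [h - 1 >= t], a set [X] of [h - 1] points lies in at most one block;
    so it suffices to find a block [b] meeting [S] exactly in [T] and to take
    [X] inside [b :\: S], which has at least [k - t] points.  Such blocks are
    counted: in a [t]-[(v, k, 1)] design, the number of blocks containing a set
    [I] and avoiding a disjoint set [J], with [#|I| + #|J| <= t], is
    ['C(v - #|I| - #|J|, k - #|I|) / 'C(v - t, k - t)], which is positive for
    [#|I| + #|J| = t] because [k <= v - t]. *)
Require Import Defs.
From mathcomp Require Import all_boot.

Set Implicit Arguments.
Unset Strict Implicit.
Unset Printing Implicit Defensive.

Definition blocks_through_avoiding (V : finType) (B : {set {set V}})
    (I J : {set V}) : {set {set V}} :=
  [set b in B | (I \subset b) && [disjoint J & b]].

(** Induction on [t - #|I|], starting from [#|I| = t], where the design axiom gives one block. The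
    factor ['C(v - t, k - t)] stays on the left so that no division occurs. *)
Lemma card_blocks_through (V : finType) (B : {set {set V}}) (t v k : nat)
    (I : {set V}) :
  is_design B t v k 1 -> t <= k -> #|I| <= t ->
  #|[set b in B | I \subset b]| * 'C(v - t, k - t) = 'C(v - #|I|, k - #|I|).
Proof.
move=> [cardV cardB coverB] le_tk.
move Dn: (t - #|I|) => n; elim: n I Dn => [|n IHn] I Dn leIt.
  have It : #|I| = t by apply/eqP; rewrite eqn_leq leIt -subn_eq0 Dn.
  by rewrite (coverB _ It) It mul1n.
have ltIt : #|I| < t by rewrite -subn_gt0 Dn.
have ltIk : #|I| < k := leq_trans ltIt le_tk.
(* Double counting of pairs [(x, b)] with [x] outside [I] and [x |: I] inside [b]: each block
   through [I] has [k - #|I|] such points. *)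
have flags : #|[set b in B | I \subset b]| * (k - #|I|)
    = \sum_(x in ~: I) #|[set b in B | x |: I \subset b]|.
  under eq_bigr => x _ do rewrite -sum1_card.
  rewrite (exchange_big_dep (mem [set b in B | I \subset b])) /=; last first.
    by move=> x b _; rewrite !inE subUset => /and3P[-> _ ->].
  rewrite -sum_nat_const; apply: eq_bigr => b; rewrite inE => /andP[bB Ib].
  rewrite sum1_card -(cardB _ bB) -(cardsDS Ib); apply: eq_card => x.
  by rewrite [RHS]unfold_in !inE bB subUset sub1set Ib andbT.
(* The absorption identity for binomials matches the flag count; the goal is multiplied by
   [k - #|I| > 0] to use it. *)
have := mul_bin_diag (v - #|I|) (k - #|I|).-1.
rewrite prednK ?subn_gt0 // -!subnS => diag.
apply/eqP; rewrite -(@eqn_pmul2l (k - #|I|)) ?subn_gt0 // -diag; apply/eqP.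
rewrite mulnA [_ * #|_|]mulnC flags big_distrl /=.
have -> : v - #|I| = #|~: I| by rewrite (cardsCs (~: I)) setCK cardV.
rewrite -sum_nat_const; apply: eq_bigr => x; rewrite inE => xI.
have cardxI : #|x |: I| = #|I|.+1 by rewrite cardsU1 xI.
by rewrite IHn cardxI // subnS Dn.
Qed.

Lemma disjoint_setU1 (V : finType) (x : V) (A C : {set V}) :
  [disjoint x |: A & C] = (x \notin C) && [disjoint A & C].
Proof. by rewrite !disjoints_subset subUset sub1set inE. Qed.

(** Induction on [#|J|]: for [x] in [J], blocks through [I] avoiding [J :\ x] either contain [x] or
    avoid all of [J], which is Pascal's rule. Moving [x] from [J] to [I] preserves [#|I| + #|J|]. *)
Lemma card_blocks_through_avoiding (V : finType) (B : {set {set V}})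
    (t v k : nat) (I J : {set V}) :
  is_design B t v k 1 -> t <= k -> k <= v -> [disjoint I & J] ->
  #|I| + #|J| <= t ->
  #|blocks_through_avoiding B I J| * 'C(v - t, k - t)
  = 'C(v - #|I| - #|J|, k - #|I|).
Proof.
move=> hD le_tk le_kv.
move Dn: #|J| => n; elim: n I J Dn => [|n IHn] I J Dn dIJ leIJ.
  have -> : J = set0 by apply/eqP; rewrite -cards_eq0 Dn.
  rewrite subn0 -(card_blocks_through hD) //; last by rewrite -[#|I|]addn0.
  congr muln; apply: eq_card => b.
  by rewrite !inE disjoints_subset sub0set andbT.
have /card_gt0P[x xJ] : 0 < #|J| by rewrite Dn.
have cardJ : #|J :\ x| = n by have := cardsD1 x J; rewrite xJ Dn => -[].
have xI : x \notin I by rewrite (disjointFl dIJ xJ).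
have cardxI : #|x |: I| = #|I|.+1 by rewrite cardsU1 xI.
have ltIt : #|I| < t by apply: leq_trans leIJ; rewrite -addSnnS leq_addr.
have ltIk := leq_trans ltIt le_tk.
have dIJx : [disjoint I & J :\ x].
  by apply: disjointWr dIJ; apply: subD1set.
have dxIJx : [disjoint x |: I & J :\ x].
  by rewrite disjoint_setU1 dIJx !inE eqxx.
have split_x : #|blocks_through_avoiding B I (J :\ x)|
    = #|blocks_through_avoiding B (x |: I) (J :\ x)|
      + #|blocks_through_avoiding B I J|.
  rewrite -(cardsID [set b : {set V} | x \in b]).
  congr addn; apply: eq_card => b; rewrite !inE.
    by rewrite subUset sub1set -!andbA; case: (x \in b); rewrite ?andbF ?andbT.
  rewrite -{2}(setD1K xJ) disjoint_setU1.
  by case: (x \in b); rewrite ?andbF ?andbT.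
have := IHn I (J :\ x) cardJ dIJx.
rewrite split_x mulnDl IHn ?cardxI ?addSnnS // => /(_ _)/esym pascal.
have {pascal} := pascal (leq_trans (leq_add (leqnn _) (leqnSn n)) leIJ).
have ltIn : 0 < v - #|I| - n.
  by rewrite -subnDA subn_gt0 -addnS (leq_trans leIJ) // (leq_trans le_tk).
(* Both arguments of the binomial are positive, so they are exposed as successors for Pascal's rule
   [binS]. *)
rewrite -(prednK ltIn) -{1}(prednK (n := k - #|I|)) ?subn_gt0 //.
have -> : v - #|I|.+1 - n = (v - #|I| - n).-1 by rewrite subnAC subnS subnAC.
rewrite binS prednK ?subn_gt0 // !subnS [in X in X = _]addnC.
by move/addnI/esym.
Qed.

Lemma exists_block_meeting_exactly (V : finType) (B : {set {set V}})
    (t v k : nat) (S T : {set V}) :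
  is_design B t v k 1 -> t <= k -> k + t <= v -> #|S| = t -> T \subset S ->
  exists2 b, b \in B & b :&: S = T.
Proof.
move=> hD le_tk le_ktv cardS TS.
have le_kv : k <= v := leq_trans (leq_addr t k) le_ktv.
have dTS : [disjoint T & S :\: T].
  by rewrite disjoints_subset; apply/subsetP => x xT; rewrite !inE xT.
have cardTS : #|T| + #|S :\: T| = t.
  by rewrite cardsDS // subnKC ?subset_leq_card.
have := card_blocks_through_avoiding hD le_tk le_kv dTS.
rewrite cardTS -subnDA cardTS => /(_ (leqnn t)) count.
(* Positivity holds because [k - #|T| <= k <= v - t]. *)
have : 0 < 'C(v - t, k - #|T|).
  rewrite bin_gt0 (leq_trans (leq_subr _ _)) // leq_subRL ?[t + k]addnC //.
  exact: leq_trans le_tk le_kv.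
rewrite -count muln_gt0 => /andP[/card_gt0P[b]].
rewrite inE => /and3P[bB Tb dSTb] _; exists b => //.
apply/setP => x; rewrite inE; apply/andP/idP => [[xb xS]|xT].
  by apply: contraTT xb => xT; rewrite (disjointFr dSTb) // inE xT.
by rewrite (subsetP Tb) ?(subsetP TS).
Qed.

(** Any [t]-subset of [X] already determines its block, since [lambda = 1]. *)
Lemma block_unique (V : finType) (B : {set {set V}}) (t v k : nat)
    (X b b' : {set V}) :
  is_design B t v k 1 -> t <= #|X| -> b \in B -> b' \in B ->
  X \subset b -> X \subset b' -> b = b'.
Proof.
move=> [_ _ coverB] leX bB b'B Xb Xb'.
have [A AX cardA] : exists2 A : {set V}, A \subset X & #|A| = t.
  have : 0 < #|[set A : {set V} | A \subset X & #|A| == t]|.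
    by rewrite cards_draws bin_gt0.
  by case/card_gt0P=> A; rewrite inE => /andP[AX /eqP]; exists A.
have /eqP/cards1P[c Dc] := coverB _ cardA.
have through a : a \in B -> X \subset a -> a = c.
  by move=> aB Xa; apply/set1P; rewrite -Dc inE aB (subset_trans AX).
by rewrite (through b bB Xb) (through b' b'B Xb').
Qed.

Theorem theorem11 (V : finType) (B : {set {set V}}) (t v k h : nat)
    (ht : 1 <= t)
    (hD : is_design B t v k 1)
    (hk : 2 * t <= k)
    (hv : k + t <= v)
    (hh3 : 3 <= h)
    (hth : t + 1 <= h)
    (hhk : h <= k - t + 1) :
  existentially_closed (design_hypergraph B h) t.
Proof.
move=> S cardS T TS.
have le_tk : t <= k by apply: leq_trans hk; rewrite leq_pmull.
have [b bB bST] := exists_block_meeting_exactly hD le_tk hv cardS TS.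
have h_gt0 : 0 < h by apply: leq_trans hh3.
have [_ cardB _] := hD.
(* There is room for [X]: [b :\: S] has [k - #|T| >= k - t >= h - 1] points. *)
have [X XbS cardX] : exists2 X : {set V}, X \subset b :\: S & #|X| = h - 1.
  have : 0 < #|[set X : {set V} | X \subset b :\: S & #|X| == h - 1]|.
    rewrite cards_draws bin_gt0 leq_subLR addnC (leq_trans hhk) // leq_add2r.
    by rewrite cardsD bST (cardB _ bB) leq_sub2l // -cardS subset_leq_card.
  by case/card_gt0P=> X; rewrite inE => /andP[XbS /eqP]; exists X.
have [Xb XS] : X \subset b /\ X \subset ~: S.
  by move: XbS; rewrite setDE subsetI => /andP.
exists X; split=> //= [z zT|s /setDP[sS]].
  have zb : z \in b by move: zT; rewrite -bST inE => /andP[].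
  have zX : z \notin X.
    by apply: contraL (subsetP TS z zT) => /(subsetP XS); rewrite inE.
  rewrite inE setUC cardsU1 zX cardX add1n subn1 prednK // eqxx /=.
  by apply/existsP; exists b; rewrite bB subUset sub1set zb.
(* A block [b'] containing [X] and [s] shares the [h - 1 >= t] points of [X] with [b], so [b' = b]
   and [s] lies in [b :&: S = T]. *)
apply: contra; rewrite inE => /andP[_ /existsP[b' /andP[b'B]]].
rewrite subUset sub1set => /andP[Xb' sb'].
have leX : t <= #|X| by rewrite cardX leq_subRL // addnC.
by rewrite -bST inE sS (block_unique hD leX bB b'B Xb Xb') sb'.
Qed.
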